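(* Let $F:\mathbb{R}^p\to\mathbb{R}^p$ be single-valued and $L$-Lipschitz continuous ($L>0$), let $T:\mathbb{R}^p\rightrightarrows 2^{\mathbb{R}^p}$ be possibly multivalued, and assume that $F+T$ is $\rho$-co-hypomonotone with $\rho\ge0$ and $2L\rho<1$, and that $\mathrm{zer}(F+T)\ne\emptyset$. Let $\{(x^k,y^k)\}$ (together with $\xi^k\in Tx^k$) be generated by the scheme (EAG) described in the context, using $$\tau_k:=\frac1{k+2},\qquad \eta\in\Big(2\rho,\frac1L\Big],\qquad \hat\eta_k:=(1-\tau_k)\eta.$$ Then, for all $k\ge0$ and any $x^\star\in\mathrm{zer}(F+T)$, $$\|Fx^k+\xi^k\|^2\le\frac{4\|x^0-x^\star\|^2+2\eta(\eta-2\rho)\|Fx^0+\xi^0\|^2}{(\eta-2\rho)^2(k+1)^2},\qquad\text{where }\xi^k\in Tx^k.$$ Consequently, if $J_{\eta T}$ is nonexpansive, then $$\|\mathcal{G}_\eta x^k\|^2\le\frac{4\|x^0-x^\star\|^2+2\eta(\eta-2\rho)\|Fx^0+\xi^0\|^2}{(\eta-2\rho)^2(k+1)^2}.$$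
   Context: $\mathbb{R}^p$ carries the standard inner product $\langle\cdot,\cdot\rangle$ and Euclidean norm $\|\cdot\|$. A (possibly multivalued) operator $G$ on $\mathbb{R}^p$ is $\rho$-co-hypomonotone if $\langle u-v,x-y\rangle\ge-\rho\|u-v\|^2$ for all $x,y$ and all $u\in Gx$, $v\in Gy$ (for $\rho=0$ this is monotonicity). $\mathrm{zer}(F+T):=\{x: 0\in Fx+Tx\}$. The resolvent is $J_{\eta T}u:=\{x\in\mathbb{R}^p: u\in x+\eta Tx\}$. ''$J_{\eta T}$ is nonexpansive'' means that $J_{\eta T}$ is a single-valued map $\mathbb{R}^p\to\mathbb{R}^p$ that is $1$-Lipschitz. In that case the residual operator is $\mathcal{G}_\eta x:=\frac1\eta\big(x-J_{\eta T}(x-\eta Fx)\big)$. Scheme (EAG): start from $x^0\in\mathbb{R}^p$ and an arbitrary $\xi^0\in Tx^0$. For each $k\ge0$, $$\begin{aligned} y^k&:=x^k+\tau_k(x^0-x^k)-\big(\hat\eta_k-2\rho(1-\tau_k)\big)(Fx^k+\xi^k),\\ x^{k+1}&:=x^k+\tau_k(x^0-x^k)-\eta(Fy^k+\xi^{k+1})+2\rho(1-\tau_k)(Fx^k+\xi^k), \end{aligned}$$ where $\xi^{k+1}\in Tx^{k+1}$. The second line is implicit in $x^{k+1}$; it is equivalent to $x^{k+1}\in J_{\eta T}\big(y^k-\eta Fy^k+\hat\eta_k(Fx^k+\xi^k)\big)$ with $\xi^{k+1}:=\frac1\eta\big(y^k-x^{k+1}-\eta Fy^k+\hat\eta_k(Fx^k+\xi^k)\big)$.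 The iterates are assumed to exist. The $\xi^k$ in the claim are those of the scheme. *)

(* Defs.v *)
From mathcomp Require Import all_boot all_order all_algebra.
From mathcomp Require Import boolp classical_sets reals.

Set Implicit Arguments.
Unset Strict Implicit.
Unset Printing Implicit Defensive.

Import Order.TTheory GRing.Theory Num.Theory.

Local Open Scope classical_set_scope.
Local Open Scope ring_scope.

Definition dotp (R : realType) (p : nat) (u v : 'rV[R]_p) : R :=
  \sum_(i < p) u 0 i * v 0 i.

(* The Euclidean norm. MathComp-Analysis equips matrices with the sup norm
   under the notation `|u|, so neither that norm nor the library's Lipschitz
   predicates, which are stated with it, can be used here. *)
Definition enorm (R : realType) (p : nat) (u : 'rV[R]_p) : R :=
  Num.sqrt (dotp u u).

Definition elipschitz (R : realType) (p : nat) (L : R)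
    (f : 'rV[R]_p -> 'rV[R]_p) : Prop :=
  forall x y, enorm (f x - f y) <= L * enorm (x - y).

Definition operator (R : realType) (p : nat) : Type :=
  'rV[R]_p -> set 'rV[R]_p.

Definition add_op (R : realType) (p : nat) (F : 'rV[R]_p -> 'rV[R]_p)
    (T : operator R p) : operator R p :=
  fun x => [set F x + u | u in T x].

Definition co_hypomonotone (R : realType) (p : nat) (rho : R)
    (G : operator R p) : Prop :=
  forall x y u v, G x u -> G y v ->
    - rho * enorm (u - v) ^+ 2 <= dotp (u - v) (x - y).

Definition zer (R : realType) (p : nat) (G : operator R p) : set 'rV[R]_p :=
  [set x | G x 0].

(* J_{eta T} u = {x | u \in x + eta T x}. *)
Definition resolvent (R : realType) (p : nat) (eta : R) (T : operator R p) :
    operator R p :=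
  fun u => [set x | exists2 v, T x v & u = x + eta *: v].

(* G is the everywhere defined, single-valued map J, and J is 1-Lipschitz. *)
Definition nonexpansive_map (R : realType) (p : nat) (G : operator R p)
    (J : 'rV[R]_p -> 'rV[R]_p) : Prop :=
  (forall u, G u = [set J u]) /\ elipschitz 1 J.

(* J stands for the single-valued resolvent J_{eta T}. *)
Definition residual (R : realType) (p : nat) (eta : R)
    (F J : 'rV[R]_p -> 'rV[R]_p) (x : 'rV[R]_p) : 'rV[R]_p :=
  eta^-1 *: (x - J (x - eta *: F x)).

(* The scheme is implicit in x k.+1, so it is a relation satisfied by the
   sequences x, y, xi and not a recursive definition of them. *)
Record EAG (R : realType) (p : nat) (F : 'rV[R]_p -> 'rV[R]_p)
    (T : operator R p) (rho eta : R) (tau etahat : nat -> R)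
    (x y xi : nat -> 'rV[R]_p) : Prop := {
  EAG_xi : forall k, T (x k) (xi k);
  EAG_y : forall k,
    y k = x k + tau k *: (x 0%N - x k)
          - (etahat k - 2 * rho * (1 - tau k)) *: (F (x k) + xi k);
  EAG_x : forall k,
    x k.+1 = x k + tau k *: (x 0%N - x k)
             - eta *: (F (y k) + xi k.+1)
             + (2 * rho * (1 - tau k)) *: (F (x k) + xi k)
}.

(* Main.v *)
Require Import Defs.
From mathcomp Require Import all_boot all_order all_algebra.
From mathcomp Require Import boolp classical_sets reals.
From mathcomp Require Import ring lra.

(** Write [w k := F (x k) + xi k], a value of [F + T] at [x k], and
    [v k := F (y k) + xi k.+1].  The proof is a Lyapunov argument: the energy
    [(eta (k+1)^2 / 2 - rho k (k+1)) |w k|^2 + (k+1) <w k, x k - x 0>]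
    does not increase along the scheme ([energy_step]).  Two inequalities give
    the decrease.  Co-hypomonotonicity between two successive iterates, once
    the increment of [x] is replaced by the scheme, makes the inner products
    with [x 0] telescope, together with the terms in [rho]; what remains is a
    combination of [<w k.+1, v k>] and [<w k, v k>].  That combination is
    bounded below by the Lipschitz estimate for [F] between [x k.+1] and [y k]
    ([lipschitz_correction]), where [eta <= 1 / L] absorbs the constant.

    The initial energy is [eta / 2 * |w 0|^2].  Conversely,
    co-hypomonotonicity between [x k] and a zero [xs] bounds the energy below
    by [(k+1)^2 (eta - 2 rho) / 2 * |w k|^2 + (k+1) <w k, xs - x 0>], and
    Young's inequality turns this into the rate ([rate_of_energy]).

    The rate for the residual follows because [x k] is itself the resolvent
    of [x k + eta xi k]: a nonexpansive resolvent moves by at most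
    [eta |w k|] when its argument becomes [x k - eta F (x k)]
    ([residual_le]). *)

Import Order.TTheory GRing.Theory Num.Theory.

Local Open Scope classical_set_scope.
Local Open Scope ring_scope.

(** * The Euclidean inner product *)

Section InnerProduct.
Context {R : realType} {p : nat}.
Implicit Types (u v w : 'rV[R]_p) (c : R).

Lemma dotpC u v : dotp u v = dotp v u.
Proof. by apply: eq_bigr => i _; rewrite mulrC. Qed.

Lemma dotpDl u v w : dotp (u + v) w = dotp u w + dotp v w.
Proof. by rewrite -big_split; apply: eq_bigr => i _; rewrite mxE mulrDl. Qed.

Lemma dotpZl c u v : dotp (c *: u) v = c * dotp u v.
Proof. by rewrite mulr_sumr; apply: eq_bigr => i _; rewrite mxE mulrA. Qed.

Lemma dotpNl u v : dotp (- u) v = - dotp u v.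
Proof. by rewrite -scaleN1r dotpZl mulN1r. Qed.

Lemma dotpDr u v w : dotp u (v + w) = dotp u v + dotp u w.
Proof. by rewrite dotpC dotpDl !(dotpC u). Qed.

Lemma dotpZr c u v : dotp u (c *: v) = c * dotp u v.
Proof. by rewrite dotpC dotpZl (dotpC u). Qed.

Lemma dotpNr u v : dotp u (- v) = - dotp u v.
Proof. by rewrite dotpC dotpNl (dotpC u). Qed.

Definition dotpE := (dotpDl, dotpDr, dotpNl, dotpNr, dotpZl, dotpZr).

Lemma dotp_ge0 u : 0 <= dotp u u.
Proof. by apply: sumr_ge0 => i _; rewrite -expr2 sqr_ge0. Qed.

Lemma enorm_sqr u : enorm u ^+ 2 = dotp u u.
Proof. by rewrite sqr_sqrtr ?dotp_ge0. Qed.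

Lemma elipschitz_sqr {c} {f : 'rV[R]_p -> 'rV[R]_p} : elipschitz c f ->
  forall u v, dotp (f u - f v) (f u - f v) <= c ^+ 2 * dotp (u - v) (u - v).
Proof.
move=> flip u v; rewrite -!enorm_sqr -exprMn.
have le_f := flip u v.
have f_ge0 : 0 <= enorm (f u - f v) by exact: sqrtr_ge0.
by rewrite lerXn2r ?nnegrE // (le_trans f_ge0).
Qed.

End InnerProduct.

(** * The energy decreases *)

Section Energy.
Context {R : realType} {p : nat}.
Implicit Types (w d v : 'rV[R]_p).

(** With [n = k + 1]; [d] stands for [x k - x 0].  The [rho] coefficient
    [(n - 1) n] is forced by telescoping: substituting the scheme in the
    co-hypomonotonicity inequality produces exactly [(n - 1) n |w k|^2] against
    [n (n + 1) |w k.+1|^2]. *)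
Definition energy (eta rho n : R) w d : R :=
  (eta * n ^+ 2 / 2 - rho * ((n - 1) * n)) * dotp w w + n * dotp w d.

(** Here [v] is the direction [F (y k) + xi k.+1] of the implicit step, and
    [w'], [d'] are the data of the next iterate.  The relation between [d'] and
    [d] is the scheme with its denominators [n + 1] cleared.  The inequality is
    [n (n + 1)] times the co-hypomonotonicity bound plus [eta / 2] times the
    Lipschitz bound, after pairing the scheme with [w'] and with [w]. *)
Lemma energy_step (eta rho n : R) w w' v d d' :
  0 <= eta -> 0 <= n ->
  (n + 1) *: d' = n *: d - ((n + 1) * eta) *: v + (2 * rho * n) *: w ->
  (n + 1) ^+ 2 * dotp (w' - v) (w' - v)
    <= dotp ((n + 1) *: v - n *: w) ((n + 1) *: v - n *: w) ->
  - rho * dotp (w' - w) (w' - w) <= dotp (w' - w) (d' - d) ->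
  energy eta rho (n + 1) w' d' <= energy eta rho n w d.
Proof.
move=> eta_ge0 n_ge0 scheme lip cohypo.
have scheme_w' := congr1 (dotp w') scheme.
have scheme_w := congr1 (dotp w) scheme.
have half_eta_ge0 : 0 <= eta / 2 by lra.
have nn_ge0 : 0 <= n * (n + 1) by rewrite mulr_ge0 //; lra.
have := ler_wpM2l half_eta_ge0 lip.
have := ler_wpM2l nn_ge0 cohypo.
move: scheme_w' scheme_w; rewrite /energy !dotpE.
rewrite !(dotpC w w') !(dotpC v w') !(dotpC v w).
move=> /(congr1 ( *%R (n + 1))) scheme_w' /(congr1 ( *%R n)) scheme_w.
lra.
Qed.

(** The distance [|x k.+1 - y k|] is [eta] times that between [v] and
    [(1 - tau k) w k]; since [L eta <= 1], passing through [F] makes it no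
    larger than the latter. *)
Lemma lipschitz_correction (F : 'rV[R]_p -> 'rV[R]_p) (L eta n : R)
    (x' y xi' w : 'rV[R]_p) :
  elipschitz L F -> 0 <= L * eta <= 1 ->
  (n + 1) *: (x' - y) = - eta *: ((n + 1) *: (F y + xi') - n *: w) ->
  (n + 1) ^+ 2 * dotp (F x' + xi' - (F y + xi')) (F x' + xi' - (F y + xi'))
    <= dotp ((n + 1) *: (F y + xi') - n *: w) ((n + 1) *: (F y + xi') - n *: w).
Proof.
move=> Flip /andP[Leta_ge0 Leta_le1].
set r := _ - n *: w => gap.
have -> : F x' + xi' - (F y + xi') = F x' - F y.
  by rewrite opprD addrACA subrr addr0.
have sq_ge0 : 0 <= (n + 1) ^+ 2 by exact: sqr_ge0.
apply: le_trans (ler_wpM2l sq_ge0 (elipschitz_sqr Flip x' y)) _.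
have -> : (n + 1) ^+ 2 * (L ^+ 2 * dotp (x' - y) (x' - y)) =
          (L * eta) ^+ 2 * dotp r r.
  transitivity (L ^+ 2 * dotp ((n + 1) *: (x' - y)) ((n + 1) *: (x' - y))).
    by rewrite !(dotpZl, dotpZr); ring.
  by rewrite gap !(dotpZl, dotpZr); ring.
by rewrite ler_piMl ?dotp_ge0 // exprn_ile1.
Qed.

(** The third hypothesis is co-hypomonotonicity between the current iterate
    and a zero at displacement [ds] from the starting point.  Young's
    inequality appears as the nonnegativity of
    [|(n (eta - 2 rho) / 2) w + ds|^2]. *)
Lemma rate_of_energy (eta rho n E : R) w d ds :
  0 < eta - 2 * rho -> 0 < n ->
  - rho * dotp w w <= dotp w (d - ds) ->
  energy eta rho n w d <= eta / 2 * E ->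
  dotp w w <= (4 * dotp ds ds + 2 * eta * (eta - 2 * rho) * E)
              / ((eta - 2 * rho) ^+ 2 * n ^+ 2).
Proof.
move=> s_gt0 n_gt0 cohypo.
rewrite ler_pdivlMr ?mulr_gt0 ?exprn_gt0 // /energy => le_energy.
have sn_ge0 : 0 <= (eta - 2 * rho) * n by rewrite mulr_ge0 ?ltW.
have := dotp_ge0 ((n * (eta - 2 * rho) / 2) *: w + ds).
have := ler_wpM2l (ltW s_gt0) le_energy.
have := ler_wpM2l sn_ge0 cohypo.
rewrite !dotpE !(dotpC ds w).
lra.
Qed.

End Energy.

(** * The residual operator *)

(** By definition of the resolvent, [x = J (x + eta *: xi)] for [xi] in [T x],
    and this argument of [J] differs from [x - eta *: F x] by
    [eta *: (F x + xi)]. *)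
Lemma residual_le {R : realType} {p : nat} {F J : 'rV[R]_p -> 'rV[R]_p}
    {T : operator R p} {eta : R} {x xi : 'rV[R]_p} :
  0 < eta -> nonexpansive_map (resolvent eta T) J -> T x xi ->
  enorm (residual eta F J x) ^+ 2 <= enorm (F x + xi) ^+ 2.
Proof.
move=> eta_gt0 [Jres Jlip] Tx.
have xE : x = J (x + eta *: xi).
  have : resolvent eta T (x + eta *: xi) x by exists xi.
  by rewrite Jres.
have := elipschitz_sqr Jlip (x + eta *: xi) (x - eta *: F x).
rewrite -xE expr1n mul1r.
have -> : x + eta *: xi - (x - eta *: F x) = eta *: (F x + xi).
  by rewrite opprB addrCA [x + _]addrC addrK addrC scalerDr addrC.
rewrite !enorm_sqr /residual !(dotpZl, dotpZr) => le_J.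
by rewrite mulrA -invfM mulrC ler_pdivrMr ?mulr_gt0 // mulrC -mulrA.
Qed.

(** * The convergence rate *)

Theorem theorem5p1 (R : realType) (p : nat)
  (F : 'rV[R]_p -> 'rV[R]_p) (T : operator R p) (L rho eta : R)
  (tau etahat : nat -> R) (x y xi : nat -> 'rV[R]_p)
  (hL : 0 < L) (hF : elipschitz L F)
  (hrho : 0 <= rho) (hLrho : 2 * L * rho < 1)
  (hFT : co_hypomonotone rho (add_op F T))
  (hzer : zer (add_op F T) !=set0)
  (heta : 2 * rho < eta <= 1 / L)
  (htau : forall k, tau k = 1 / (k + 2)%:R)
  (hetahat : forall k, etahat k = (1 - tau k) * eta)
  (hEAG : EAG F T rho eta tau etahat x y xi) :
  (forall (k : nat) (xs : 'rV[R]_p), zer (add_op F T) xs ->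
     enorm (F (x k) + xi k) ^+ 2 <=
       (4 * enorm (x 0%N - xs) ^+ 2
        + 2 * eta * (eta - 2 * rho) * enorm (F (x 0%N) + xi 0%N) ^+ 2)
       / ((eta - 2 * rho) ^+ 2 * (k + 1)%:R ^+ 2)) /\
  (forall J : 'rV[R]_p -> 'rV[R]_p,
     nonexpansive_map (resolvent eta T) J ->
     forall (k : nat) (xs : 'rV[R]_p), zer (add_op F T) xs ->
     enorm (residual eta F J (x k)) ^+ 2 <=
       (4 * enorm (x 0%N - xs) ^+ 2
        + 2 * eta * (eta - 2 * rho) * enorm (F (x 0%N) + xi 0%N) ^+ 2)
       / ((eta - 2 * rho) ^+ 2 * (k + 1)%:R ^+ 2)).
Proof.
case/andP: heta => eta_gt eta_leL.
have s_gt0 : 0 < eta - 2 * rho by lra.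
have eta_gt0 : 0 < eta by lra.
have Leta : 0 <= L * eta <= 1.
  have etaL : eta * L <= 1 by rewrite -ler_pdivlMr.
  by apply/andP; split; [rewrite mulr_ge0 ?ltW | rewrite mulrC].
case: hEAG => xiT yE xE.
pose w k := F (x k) + xi k.
have wFT k : add_op F T (x k) (w k) by exists (xi k).
have cohypo a b u v : add_op F T a u -> add_op F T b v ->
    - rho * dotp (u - v) (u - v) <= dotp (u - v) (a - b).
  by move=> au bv; rewrite -enorm_sqr; exact: hFT.
(* The shift makes [tau k = 1 / (n k + 1)] and [1 - tau k = n k / (n k + 1)]. *)
pose n k : R := k.+1%:R.
have n_gt0 k : 0 < n k by rewrite ltr0Sn.
have nS k : n k.+1 = n k + 1 by rewrite /n -natr1.
have n1_neq0 k : n k + 1 != 0 by rewrite -nS gt_eqF.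
have tauE k : tau k = (n k + 1)^-1 by rewrite htau addn2 -nS mul1r.
have decrease k : energy eta rho (n k.+1) (w k.+1) (x k.+1 - x 0%N)
               <= energy eta rho (n k) (w k) (x k - x 0%N).
  rewrite nS; apply: (@energy_step _ _ _ _ _ _ _ (F (y k) + xi k.+1)).
  - exact: ltW.
  - exact: ltW.
  - rewrite xE tauE -/(w k); apply/rowP => i; rewrite !mxE.
    by move: (n k) (n1_neq0 k) => m m_neq0; field.
  - apply: (@lipschitz_correction _ _ F L eta) => //.
    rewrite xE [X in _ - X]yE hetahat tauE -/(w k).
    by apply/rowP => i; rewrite !mxE; move: (n k) (n1_neq0 k) => m m_neq0; field.
  - have -> : x k.+1 - x 0%N - (x k - x 0%N) = x k.+1 - x k.
      by rewrite opprB addrA subrK.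
    exact: cohypo.
have energy_le k : energy eta rho (n k) (w k) (x k - x 0%N)
                <= eta / 2 * enorm (w 0%N) ^+ 2.
  elim: k => [|k IHk]; last exact: le_trans (decrease k) IHk.
  by rewrite enorm_sqr /energy /n subrr !dotpE; lra.
have rate k xs : zer (add_op F T) xs ->
    enorm (w k) ^+ 2 <=
      (4 * enorm (x 0%N - xs) ^+ 2
       + 2 * eta * (eta - 2 * rho) * enorm (w 0%N) ^+ 2)
      / ((eta - 2 * rho) ^+ 2 * (k + 1)%:R ^+ 2).
  move=> zxs; have := cohypo _ _ _ _ (wFT k) zxs.
  rewrite subr0 addn1 !enorm_sqr => cohypo_xs.
  have -> : dotp (x 0%N - xs) (x 0%N - xs) = dotp (xs - x 0%N) (xs - x 0%N).
    by rewrite -opprB dotpNl dotpNr opprK.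
  apply: (@rate_of_energy _ _ _ _ (n k) _ _ (x k - x 0%N)) => //.
    by rewrite opprB addrA subrK.
  by rewrite -enorm_sqr.
split=> [|J hJ k xs zxs]; first exact: rate.
exact: le_trans (residual_le eta_gt0 hJ (xiT k)) (rate k xs zxs).
Qed.
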